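(* Let $G_S$ be a self-loop graph with $\sigma=|S|\ge1$ and loop vector $s$, and let $\widetilde G$ be its Açıkmeşe lift. With $M_k(B)=\mathrm{Tr}(B^k)$ for a real symmetric matrix $B$, the first three Laplacian spectral moments of $\widetilde G$ are $$M_1(\mathcal{L}(\widetilde G))=2M_1(\mathcal{L}(G_S))+2\sigma,$$ $$M_2(\mathcal{L}(\widetilde G))=2M_2(\mathcal{L}(G_S))+4\sigma^2+4\sigma,$$ $$M_3(\mathcal{L}(\widetilde G))=2M_3(\mathcal{L}(G_S))+8\sigma^3+12\sigma^2+6\,s^\top\mathcal{L}(G_S)s.$$
   Context: Let $G$ be a finite undirected simple graph with vertex set $V=\{1,\dots,N\}$ (possibly disconnected), and $S\subseteq V$. The self-loop graph $G_S$ is obtained from $G$ by attaching one loop at every vertex of $S$; $\sigma=|S|$. The loop vector $s\in\mathbb{R}^N$ is the indicator vector of $S$. $\mathcal{L}(G)=D(G)-A(G)$ is the ordinary Laplacian and $\mathcal{L}(G_S):=\mathcal{L}(G)+\mathrm{diag}(s)$. For $\sigma\ge1$, the Açıkmeşe lift $\widetilde G=(\widetilde V,\widetilde E)$ of $G_S$ is the simple graph on $\widetilde V=\{1,\dots,2N+1\}$ such that: for each edge $\{i,j\}$ of $G$, both $\{i,j\}$ and $\{i+N+1,j+N+1\}$ are edges of $\widetilde G$; for each $i\in S$, both $\{i,N+1\}$ and $\{N+1,i+N+1\}$ are edges; there are no other edges. $\mathcal{L}(\widetilde G)$ is the ordinary Laplacian of $\widetilde G$. *)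

(* Defs.v *)
From HB Require Import structures.
From mathcomp Require Import all_boot all_order all_algebra.

Set Implicit Arguments.
Unset Strict Implicit.
Unset Printing Implicit Defensive.

Import Order.TTheory GRing.Theory Num.Theory.

(* Vertex labels are shifted by one: {1, ..., n} is represented by
   'I_n = {0, ..., n-1}. *)
Record simple_graph (n : nat) := SimpleGraph {
  adj :> rel 'I_n;
  adj_sym : symmetric adj;
  adj_irrefl : irreflexive adj
}.

Definition degree n (G : simple_graph n) (i : 'I_n) : nat :=
  #|[set j | adj G i j]|.

(* In labels starting from 0, vertex i of G has the copies i and i + N + 1,
   and the hub N + 1 of the 1-based labelling becomes N. *)
Definition lift_arc N (G : simple_graph N) (S : {set 'I_N}) (x y : nat) : bool :=
  [|| [exists i : 'I_N, exists j : 'I_N,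
        adj G i j && (((x == i) && (y == j))
                   || ((x == i + N + 1) && (y == j + N + 1)))]
    | [exists i in S, ((x == i) && (y == N)) || ((x == N) && (y == i + N + 1))]].

Definition lift_adj N (G : simple_graph N) (S : {set 'I_N}) :
    rel 'I_(2 * N + 1) :=
  fun x y => lift_arc G S x y || lift_arc G S y x.

Lemma lift_adj_sym N (G : simple_graph N) (S : {set 'I_N}) :
  symmetric (lift_adj G S).
Proof. by move=> x y; rewrite /lift_adj orbC. Qed.

Lemma lift_adj_irrefl N (G : simple_graph N) (S : {set 'I_N}) :
  irreflexive (lift_adj G S).
Proof.
move=> x; rewrite /lift_adj orbb; apply/negP => /orP[|].
- move=> /existsP[i /existsP[j /andP[Gij ij]]].
  suff eij : i = j by rewrite eij adj_irrefl in Gij.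
  apply/val_inj; case/orP: ij => /andP[/eqP xi /eqP xj].
    by rewrite /= -xi -xj.
  by apply/eqP; rewrite -(eqn_add2r N) -(eqn_add2r 1) -xi -xj.
- move=> /exists_inP[i _ /orP[|]] /andP[/eqP-> /eqP].
    by move=> iN; have := ltn_ord i; rewrite iN ltnn.
  by move/eqP; rewrite addnAC addn1 -[X in X == _]add0n eqn_add2r.
Qed.

Definition lift_graph N (G : simple_graph N) (S : {set 'I_N}) :
    simple_graph (2 * N + 1) :=
  SimpleGraph (lift_adj_sym G S) (lift_adj_irrefl G S).

Local Open Scope ring_scope.

Section Matrices.

Variable R : realFieldType.

Definition adjacency_mx n (G : simple_graph n) : 'M[R]_n :=
  \matrix_(i, j) (adj G i j)%:R.

Definition degree_mx n (G : simple_graph n) : 'M[R]_n :=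
  diag_mx (\row_i (degree G i)%:R).

Definition laplacian n (G : simple_graph n) : 'M[R]_n :=
  degree_mx G - adjacency_mx G.

Definition loop_vector n (S : {set 'I_n}) : 'cV[R]_n :=
  \col_i (i \in S)%:R.

Definition loop_laplacian n (G : simple_graph n) (S : {set 'I_n}) : 'M[R]_n :=
  laplacian G + diag_mx (loop_vector S)^T.

Definition moment n (k : nat) (B : 'M[R]_n) : R := \tr (B ^+ k).

End Matrices.

Arguments laplacian R {n} G.
Arguments loop_vector R {n} S.
Arguments loop_laplacian R {n} G S.

(* Main.v *)
Require Import Defs.
From mathcomp Require Import all_boot all_order all_algebra.
From mathcomp Require Import zify ring.

Import Order.TTheory GRing.Theory Num.Theory.
Local Open Scope ring_scope.

(** Moving the hub of the lift behind the two copies of [G] puts the Laplacian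
    of the lift into bordered block form
<<
      [ LS   0   -s ]
      [ 0    LS  -s ]
      [ -s^T -s^T 2 sigma ]
>>
    where [LS] is the Laplacian of the self-loop graph and [s] the loop vector:
    the edge from a looped vertex to the hub adds one to its degree, exactly as
    [diag s] does, and the hub has degree [2 sigma].  Relabelling vertices does
    not change a moment ([moment_mxsub]), and the low moments of a bordered
    matrix with corner [c], border [u], [v] and main block [B] are polynomials
    in [c], [v u], [v B u] and the moments of [B] ([moment2_bordered],
    [moment3_bordered]).  Here [v u = 2 s^T s = 2 sigma] because [s] is a 0-1
    vector, and [v B u = 2 s^T LS s].

    The block form is established for the adjacency matrix
    ([adjacency_lift]), where it is a case analysis on edges; it passes to the
    Laplacian because the latter is a function of the adjacency matrix alone
    ([laplacianE]): the degrees are the row sums. *)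

(** * Moments of bordered, block diagonal and relabelled matrices *)

Section BorderedMoments.

Variables (R : realFieldType) (n : nat).
Variables (B : 'M[R]_n) (u : 'cV[R]_n) (v : 'rV[R]_n) (c : R).

Let T := block_mx B u v c%:M.

Lemma trace_outer (x : 'cV[R]_n) (y : 'rV[R]_n) :
  \tr (x *m y) = (y *m x) 0 0.
Proof. by rewrite mxtrace_mulC /mxtrace big_ord1. Qed.

Lemma trace_mx11 (x : 'M[R]_1) : \tr x = x 0 0.
Proof. by rewrite /mxtrace big_ord1. Qed.

Lemma moment1_bordered : moment 1 T = moment 1 B + c.
Proof. by rewrite /moment !expr1 mxtrace_block mxtrace_scalar. Qed.

(** Reading the trace as a weighted count of closed walks: a walk of length two
    that neither stays at the corner nor stays inside the main block crosses
    the border once each way, from either of two starting points. *)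
Lemma moment2_bordered :
  moment 2 T = moment 2 B + 2 * (v *m u) 0 0 + c ^+ 2.
Proof.
rewrite /moment !expr2 -!mulmxE mulmx_block mxtrace_block !mxtraceD.
rewrite trace_outer -scalar_mxM mxtrace_scalar /mxtrace big_ord1.
by ring.
Qed.

(** The closed walks of length three that cross the border spend their third
    step either in the main block or at the corner; the factor three is the
    choice of the starting point. *)
Lemma moment3_bordered :
  moment 3 T = moment 3 B + 3 * (v *m B *m u) 0 0 + 3 * c * (v *m u) 0 0
               + c ^+ 3.
Proof.
rewrite /moment !exprS !expr0 !mulr1 -!mulmxE !mulmx_block mxtrace_block.
rewrite !mulmxDr !mxtraceD !mul_mx_scalar !mul_scalar_mx.
rewrite -!scalemxAr !mxtraceZ mxtrace_scalar (mulmxA B u v) !trace_outer.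
by rewrite !trace_mx11 !mulmxA mulr1n; ring.
Qed.

End BorderedMoments.

Lemma moment_diag (R : realFieldType) (n k : nat) (A : 'M[R]_n) :
  moment k (block_mx A 0 0 A) = 2 * moment k A.
Proof.
suff -> : moment k (block_mx A 0 0 A) =
          \tr (block_mx (A ^+ k) 0 0 (A ^+ k)).
  by rewrite mxtrace_block /moment; ring.
congr (\tr _); elim: k => [|k IHk]; first by rewrite !expr0 -scalar_mx_block.
by rewrite !exprS IHk -!mulmxE mulmx_block !(mulmx0, mul0mx, addr0, add0r).
Qed.

Section Relabelling.

Variables (R : realFieldType) (m n : nat) (f : 'I_m -> 'I_n).
Hypothesis f_bij : bijective f.

Lemma mulmx_mxsub (p q r s : nat) (g : 'I_p -> 'I_q) (h : 'I_r -> 'I_s)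
    (A : 'M[R]_(q, n)) (B : 'M[R]_(n, s)) :
  mxsub g h (A *m B) = mxsub g f A *m mxsub f h B.
Proof.
apply/matrixP => i j; rewrite !mxE (reindex f) /=; last exact: onW_bij.
by apply: eq_bigr => k _; rewrite !mxE.
Qed.

Lemma moment_mxsub (k : nat) (A : 'M[R]_n) :
  moment k (mxsub f f A) = moment k A.
Proof.
have -> : moment k (mxsub f f A) = \tr (mxsub f f (A ^+ k)).
  congr (\tr _); elim: k => [|k IHk].
    rewrite !expr0; apply/matrixP => i j.
    by rewrite !mxE (bij_eq f_bij).
  by rewrite !exprS IHk -!mulmxE mulmx_mxsub.
rewrite /moment /mxtrace [RHS](reindex f) /=; last exact: onW_bij.
by apply: eq_bigr => i _; rewrite mxE.
Qed.

End Relabelling.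

(** * The Laplacian as a function of the adjacency matrix *)

Section AdjacencyToLaplacian.

Variable R : realFieldType.

(** Stated for arbitrary square matrices, so that relabellings and block
    decompositions of the adjacency matrix can be pushed through it. *)
Definition row_sum_laplacian {n} (A : 'M[R]_n) : 'M[R]_n :=
  diag_mx (A *m const_mx 1)^T - A.

Lemma laplacianE n (G : simple_graph n) :
  laplacian R G = row_sum_laplacian (adjacency_mx R G).
Proof.
congr (diag_mx _ - _); apply/rowP => i; rewrite !mxE /degree cardsE -sum1_card.
rewrite natr_sum big_mkcond /=; apply: eq_bigr => j _.
by rewrite !mxE mulr1 unfold_in -/(adj G i j); case: (adj G i j).
Qed.

Lemma row_sum_laplacian_mxsub m n (f : 'I_m -> 'I_n) (A : 'M[R]_n) :
  bijective f ->
  mxsub f f (row_sum_laplacian A) = row_sum_laplacian (mxsub f f A).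
Proof.
move=> f_bij; apply/matrixP => i j.
rewrite !mxE (bij_eq f_bij) (reindex f) /=; last exact: onW_bij.
by congr (_ *+ _ - _); apply: eq_bigr => k _; rewrite !mxE.
Qed.

Lemma row_sum_laplacian_block m n (A : 'M[R]_m) (B : 'M[R]_(m, n))
    (C : 'M[R]_(n, m)) (D : 'M[R]_n) :
  row_sum_laplacian (block_mx A B C D) =
  block_mx (row_sum_laplacian A + diag_mx (B *m const_mx 1)^T) (- B)
           (- C) (row_sum_laplacian D + diag_mx (C *m const_mx 1)^T).
Proof.
rewrite /row_sum_laplacian -col_mx_const mul_block_col tr_col_mx diag_mx_row.
rewrite opp_block_mx add_block_mx !add0r !linearD /=.
by congr (block_mx _ _ _ _); [rewrite addrAC | rewrite -addrA [LHS]addrC].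
Qed.

End AdjacencyToLaplacian.

Arguments row_sum_laplacian {R n} A.

(** * Block form of the lift *)

Section LiftBlocks.

Variables (R : realFieldType) (N : nat) (G : simple_graph N) (S : {set 'I_N}).

Let A := adjacency_mx R G.
Let s := loop_vector R S.

Fact lift_vertex_subproof (x : 'I_(N + N + 1)) :
  ((if x < N then x : nat else if x < N + N then x.+1 else N) < 2 * N + 1)%N.
Proof. by have := ltn_ord x; do 2?case: ifP; lia. Qed.

(** The hub, which sits between the two copies in the lift, is made the last
    vertex. *)
Definition lift_vertex (x : 'I_(N + N + 1)) : 'I_(2 * N + 1) :=
  Ordinal (lift_vertex_subproof x).

Lemma lift_vertex_bij : bijective lift_vertex.
Proof.
apply: inj_card_bij; last by rewrite !card_ord; lia.
move=> x y /(congr1 val) /= exy; apply/val_inj => /=.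
by have := ltn_ord x; have := ltn_ord y; move: exy; do 4?case: ifP; lia.
Qed.

Lemma lift_vertex_fst (i : 'I_N) : lift_vertex (lshift 1 (lshift N i)) = i :> nat.
Proof. by rewrite /= ltn_ord. Qed.

Lemma lift_vertex_snd (i : 'I_N) :
  lift_vertex (lshift 1 (rshift N i)) = (i + N + 1)%N :> nat.
Proof. by have := ltn_ord i; rewrite /=; do 2?case: ifP; lia. Qed.

Lemma lift_vertex_hub (i : 'I_1) : lift_vertex (rshift (N + N) i) = N :> nat.
Proof. by rewrite /=; do 2?case: ifP; lia. Qed.

Definition lift_vertexE := (lift_vertex_fst, lift_vertex_snd, lift_vertex_hub).

Lemma lift_arcP (x y : nat) :
  reflect
    ((exists i j : 'I_N, adj G i j /\
        (x = i /\ y = j \/ x = (i + N + 1)%N /\ y = (j + N + 1)%N)) \/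
     (exists2 i : 'I_N, i \in S &
        x = i /\ y = N \/ x = N /\ y = (i + N + 1)%N))
    (lift_arc G S x y).
Proof.
apply: (iffP orP) => -[].
- by case/existsP=> i /existsP[j /andP[Gij xy]]; left; exists i, j; split=> //; lia.
- by case/exists_inP=> i Si xy; right; exists i => //; lia.
- case=> i [j [Gij xy]]; left; apply/existsP; exists i; apply/existsP; exists j.
  by rewrite Gij /=; lia.
- by case=> i Si xy; right; apply/exists_inP; exists i => //; lia.
Qed.

Lemma lift_arc_fst (i j : 'I_N) : lift_arc G S i j = adj G i j.
Proof.
have [ltiN ltjN] := (ltn_ord i, ltn_ord j).
apply/lift_arcP/idP => [[[i' [j' [Gij ij]]]|[k _ ij]]|Gij]; last 2 first.
- by lia.
- by left; exists i, j; split=> //; left.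
have [-> ->] // : i = i' /\ j = j'.
by split; apply/val_inj => /=; lia.
Qed.

Lemma lift_arc_snd (i j : 'I_N) :
  lift_arc G S (i + N + 1) (j + N + 1) = adj G i j.
Proof.
have [ltiN ltjN] := (ltn_ord i, ltn_ord j).
apply/lift_arcP/idP => [[[i' [j' [Gij ij]]]|[k _ ij]]|Gij]; last 2 first.
- by lia.
- by left; exists i, j; split=> //; right.
have [ltiN' ltjN'] := (ltn_ord i', ltn_ord j').
have [-> ->] // : i = i' /\ j = j'.
by split; apply/val_inj => /=; lia.
Qed.

Lemma lift_arc_to_hub (i : 'I_N) : lift_arc G S i N = (i \in S).
Proof.
have ltiN := ltn_ord i.
apply/lift_arcP/idP => [[[i' [j' [_ ij]]]|[k Sk ik]]|Si]; last 2 first.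
- by have -> // : i = k by apply/val_inj => /=; lia.
- by right; exists i => //; left.
by have := ltn_ord j'; lia.
Qed.

Lemma lift_arc_from_hub (i : 'I_N) : lift_arc G S N (i + N + 1) = (i \in S).
Proof.
have ltiN := ltn_ord i.
apply/lift_arcP/idP => [[[i' [j' [_ ij]]]|[k Sk ik]]|Si]; last 2 first.
- by have -> // : i = k by apply/val_inj => /=; lia.
- by right; exists i => //; right.
by have := ltn_ord i'; lia.
Qed.

(** No arc jumps over the hub, and an arc with the hub as an end points to the
    larger label: before symmetrization the edges at the hub are recorded in
    one orientation only. *)
Lemma lift_arcF (x y : nat) :
  [|| (x < N) && (N < y), (N < x) && (y <= N) | (x == N) && (y <= N)]%N ->
  lift_arc G S x y = false.
Proof.
move=> xy; apply/lift_arcP => -[[i [j [_ ij]]]|[i _ ij]].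
  by have [ltiN ltjN] := (ltn_ord i, ltn_ord j); lia.
by have ltiN := ltn_ord i; lia.
Qed.

Lemma adjacency_lift :
  mxsub lift_vertex lift_vertex (adjacency_mx R (lift_graph G S)) =
  block_mx (block_mx A 0 0 A) (col_mx s s) (row_mx s^T s^T) 0.
Proof.
apply/matrixP => x y; rewrite mxE mxE /= /lift_adj.
case: (split_ordP x) => {}x ->; [case: (split_ordP x) => {}x -> |];
case: (split_ordP y) => {}y ->; try (case: (split_ordP y) => {}y ->);
rewrite !lift_vertexE ?(block_mxEul, block_mxEur, block_mxEdl, block_mxEdr);
rewrite ?(row_mxEl, row_mxEr, col_mxEu, col_mxEd) !mxE.
all: have [ltxn ltyn] := (ltn_ord x, ltn_ord y).
all: rewrite 2?(lift_arc_fst, lift_arc_snd, lift_arc_to_hub, lift_arc_from_hub).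
all: rewrite ?lift_arcF ?orbF ?orFb //; try lia.
all: by rewrite [G y x]adj_sym orbb.
Qed.

Lemma loop_vector_dot : (s^T *m s) 0 0 = #|S|%:R.
Proof.
rewrite mxE -sum1_card natr_sum [RHS]big_mkcond; apply: eq_bigr => i _.
by rewrite !mxE; case: (i \in S); rewrite ?mulr1 ?mulr0.
Qed.

(** Each looped vertex has exactly one edge to the hub, so the extra degree
    of the copies is the loop term, and the hub has one edge to each copy of
    each looped vertex. *)
Lemma laplacian_lift :
  mxsub lift_vertex lift_vertex (laplacian R (lift_graph G S)) =
  block_mx (block_mx (loop_laplacian R G S) 0 0 (loop_laplacian R G S))
    (- col_mx s s) (- row_mx s^T s^T) (2 * #|S|%:R)%:M.
Proof.
have const1 : const_mx 1 = 1%:M :> 'M[R]_1.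
  by apply/matrixP => i j; rewrite !ord1 !mxE.
have s_dot1 : s^T *m const_mx 1 = #|S|%:R%:M :> 'M_1.
  apply/matrixP => i j; rewrite !ord1 -loop_vector_dot !mxE mulr1n.
  apply: eq_bigr => k _; rewrite !mxE.
  by case: (k \in S); rewrite ?mulr1 ?mulr0.
rewrite laplacianE (row_sum_laplacian_mxsub _ _ _ _ _ lift_vertex_bij).
rewrite adjacency_lift !row_sum_laplacian_block -/A const1 mulmx1.
rewrite tr_col_mx diag_mx_row !mul0mx trmx0 !linear0 !addr0 add_block_mx.
rewrite !addr0 /loop_laplacian laplacianE; congr (block_mx _ _ _ _).
rewrite -col_mx_const mul_row_col s_dot1 /row_sum_laplacian mul0mx.
rewrite trmx0 linear0 subr0 add0r.
by apply/matrixP => i j; rewrite !ord1 !mxE /= !mulr1n; ring.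
Qed.

End LiftBlocks.

(** * The first three moments of the lift *)

Theorem theorem4p1 (R : realFieldType) (N : nat) (G : simple_graph N)
    (S : {set 'I_N}) (hS : (1 <= #|S|)%N) :
  let sigma : R := #|S|%:R in
  let s : 'cV[R]_N := loop_vector R S in
  let LS : 'M[R]_N := loop_laplacian R G S in
  let Llift : 'M[R]_(2 * N + 1) := laplacian R (lift_graph G S) in
  [/\ moment 1 Llift = 2 * moment 1 LS + 2 * sigma,
      moment 2 Llift = 2 * moment 2 LS + 4 * sigma ^+ 2 + 4 * sigma
    & moment 3 Llift = 2 * moment 3 LS + 8 * sigma ^+ 3 + 12 * sigma ^+ 2
                       + 6 * (s^T *m LS *m s) 0 0].
Proof.
move=> sigma s LS Llift.
have momentE k : moment k Llift =
    moment k (block_mx (block_mx LS 0 0 LS)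
                (- col_mx s s) (- row_mx s^T s^T) (2 * sigma)%:M).
  by rewrite -laplacian_lift moment_mxsub //; apply: lift_vertex_bij.
have border_dot : (- row_mx s^T s^T *m - col_mx s s) 0 0 = 2 * sigma.
  rewrite mulNmx mulmxN opprK mul_row_col mxE loop_vector_dot.
  by rewrite /sigma; ring.
have border_form : (- row_mx s^T s^T *m block_mx LS 0 0 LS *m - col_mx s s) 0 0
    = 2 * (s^T *m LS *m s) 0 0.
  rewrite !mulNmx mulmxN opprK mul_row_block mul_row_col !mulmx0.
  by rewrite addr0 add0r mxE; ring.
split; rewrite momentE.
- by rewrite moment1_bordered moment_diag.
- by rewrite moment2_bordered moment_diag border_dot; ring.
- by rewrite moment3_bordered moment_diag border_dot border_form; ring.
Qed.
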